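(* There is no edge-girth-regular graph with parameters $(v,3,8,14)$; that is, for every positive integer $v$, no $egr(v,3,8,14)$-graph exists.
   Context: Graphs are finite, simple and undirected. For integers $v,k,g,\lambda$, an $egr(v,k,g,\lambda)$-graph (edge-girth-regular graph) is a $k$-regular graph on $v$ vertices with girth $g$ (the length of a shortest cycle is exactly $g$) such that every edge is contained in exactly $\lambda$ cycles of length $g$. *)

(* Defs.v *)
(* MathComp world. *)
From mathcomp Require Import all_boot.

Set Implicit Arguments.
Unset Strict Implicit.
Unset Printing Implicit Defensive.

(* A finite simple undirected graph is a symmetric irreflexive relation
   [e : rel T] on a finite type [T] of vertices; its edges are the pairs
   [[set x; y]] with [e x y]. *)
Section EdgeGirthRegular.

Variables (T : finType) (e : rel T).

Definition regular (k : nat) : Prop := forall x : T, #|[set y | e x y]| = k.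

(* The vertices, in cyclic order, of a cycle; sequences of size at most 2 are
   excluded because [ucycleb e [:: x; y]] holds for every edge xy. *)
Definition is_cycle (c : seq T) : bool := (3 <= size c) && ucycleb e c.

Definition cycle_edges (c : seq T) : {set {set T}} :=
  [set [set x; next c x] | x in c].

(* A cycle is counted as a subgraph, i.e. identified with its edge set, so that
   the 2n cyclic orderings (rotations and reversals) of its n vertices count
   once. *)
Definition cycles_of_length (n : nat) : {set {set {set T}}} :=
  [set cycle_edges c | c : n.-tuple T & is_cycle c].

Definition has_girth (g : nat) : Prop :=
  (exists2 c : seq T, is_cycle c & size c = g) /\
  (forall c : seq T, is_cycle c -> g <= size c).

Definition egr (v k g lambda : nat) : Prop :=
  [/\ symmetric e /\ irreflexive e, #|T| = v, regular k, has_girth g &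
      forall x y : T, e x y ->
        #|[set C in cycles_of_length g | [set x; y] \in C]| = lambda].

End EdgeGirthRegular.

(* Main.v *)
(* Fix a vertex x with neighbours 1, 2, 3, and let R_i be the set of the 8
   vertices at the end of a nonbacktracking walk x, i, _, _, r.  By girth 8, the
   8-cycles through the edge xi correspond to the elements of R_i :&: R_j for
   j <> i, so 14 of them on each edge means that all R_i :&: R_j have 7 elements.
   Looking at R_i from the neighbour i shows that no vertex lies in exactly one
   R_i; hence each pair i, j has a unique vertex d_ij in R_i and R_j only.  Looking
   again from the neighbours, all d_ij have a common neighbour w.
   Let q_ij be the neighbour of d_ij on the walk from x through i, p_ij its
   predecessor, a_ij the other successor of p_ij, and b_ij the remaining neighbour
   of q_ij.  Excluding cycles of length 4 and 6 forces b_ij to be adjacent to both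
   a_jk and a_kj, so that a_jk, b_ij, a_kj, b_ik is a 4-cycle. *)
Require Import Defs.
From mathcomp Require Import all_boot zify.

Set Implicit Arguments.
Unset Strict Implicit.
Unset Printing Implicit Defensive.

(** * Nonbacktracking walks under a girth bound *)

Section Walks.

Variables (T : finType) (e : rel T).

Fixpoint nbwalk (s : seq T) : bool :=
  if s is x :: s1 then
    if s1 is y :: s2 then
      [&& e x y, (if s2 is z :: _ then x != z else true) & nbwalk s1]
    else true
  else true.

Lemma nbwalk_behead x s : nbwalk (x :: s) -> nbwalk s.
Proof. by case: s => //= y s /and3P[]. Qed.

Lemma nbwalk_catl s t : nbwalk (s ++ t) -> nbwalk s.
Proof.
elim: s => //= x [|y [|z s]] IH //=; first by case/and3P => ->.
by case/and3P => -> -> /IH.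
Qed.

Lemma nbwalk_path x s : nbwalk (x :: s) -> path e x s.
Proof. by elim: s x => //= y s IH x /and3P[-> _ /IH]. Qed.

(** An overlap of two vertices is what gluing needs: every three consecutive vertices then lie in
    one of the two walks. *)
Lemma nbwalk_glue s y x t :
  nbwalk (s ++ [:: y; x]) -> nbwalk [:: y, x & t] -> nbwalk (s ++ [:: y, x & t]).
Proof.
elim: s => //= a [|b [|c s]] IH //=.
- by case/and3P => -> -> _.
- by case/and3P => -> -> /IH.
by case/and3P => -> -> /IH.
Qed.

Hypotheses (e_sym : symmetric e) (e_irr : irreflexive e).

Lemma nbwalk_rev s : nbwalk (rev s) = nbwalk s.
Proof.
suff H t : nbwalk t -> nbwalk (rev t).
  by apply/idP/idP; [move/H; rewrite revK | exact: H].
elim: t => // x [|y [|z t]] IH //=.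
  by rewrite /rev /= !andbT e_sym.
move=> /and3P[exy xz nb]; move: (IH nb).
rewrite !rev_cons -!cats1 -!catA /= => H.
apply: nbwalk_glue H _; case/andP: nb => eyz _ /=.
by rewrite e_sym eyz eq_sym xz e_sym exy.
Qed.

Hypothesis girth8 : forall c : seq T, is_cycle e c -> 8 <= size c.

(** By induction the tail is repetition-free, so a first return to the head closes a cycle of length
    at most 7. *)
Lemma nbwalk_uniq s : nbwalk s -> size s <= 8 -> uniq s.
Proof.
have [n] := ubnP (size s); elim: n s => // n IH [|x s] // lt_sn nb_xs le_s8.
rewrite cons_uniq; have -> : uniq s.
  by apply: IH; [exact: lt_sn | exact: nbwalk_behead nb_xs | exact: ltnW].
rewrite andbT.
apply/negP => x_s; move: nb_xs lt_sn le_s8; case/splitPr: x_s => s1 s2.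
rewrite -cat_rcons -cat_cons => nb lt_sn le_s8.
have nb1 := nbwalk_catl nb.
have nbx : nbwalk (x :: s1) by move: nb1; rewrite -rcons_cons -cats1 => /nbwalk_catl.
have us1 : uniq (x :: s1).
  by apply: IH => //=; move: lt_sn le_s8; rewrite /= size_cat size_rcons; lia.
have cyc : cycle e (x :: s1) by exact: nbwalk_path nb1.
have : is_cycle e (x :: s1).
  rewrite /is_cycle /ucycleb cyc us1 !andbT.
  (* A closed walk of length 1 is a loop and one of length 2 backtracks. *)
  case: (s1) nb1 => [|a [|b s3]] //=; first by rewrite e_irr.
  by rewrite eqxx andbF.
by move/girth8 => /=; move: le_s8; rewrite /= size_cat size_rcons; lia.
Qed.

(* Without its common prefix with [t], the walk [s] followed by [t] reversed is a
   closed nonbacktracking walk of length at most 7, hence empty by girth 8. *)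
Lemma nbwalk_inj x s t :
  nbwalk (x :: s) -> nbwalk (x :: t) -> last x s = last x t ->
  size s + size t <= 7 -> s = t.
Proof.
have closed y r : nbwalk (y :: r) -> last y r = y -> size r <= 7 -> r = [::].
  case: (lastP r) => // {}r z nb; rewrite last_rcons => zy le_r.
  by rewrite zy in nb le_r; have := nbwalk_uniq nb le_r; rewrite /= mem_rcons mem_head.
elim: s x t => [|y s IH] x [|z t] //= nbs nbt els le7.
- by rewrite (closed x (z :: t)).
- by rewrite (closed x (y :: s)) //= ; lia.
have [eyz|yz] := eqVneq y z.
  rewrite -{}eyz in nbt els *; congr (_ :: _).
  by apply: (IH y) => //; [case/and3P: nbs|case/and3P: nbt|lia].
have nb : nbwalk (rev s ++ [:: y, x, z & t]).
  apply: nbwalk_glue => /=.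
    by rewrite (_ : _ ++ _ = rev [:: x, y & s]) ?nbwalk_rev // !rev_cons -!cats1 -catA.
  by rewrite yz nbt e_sym; case/and3P: nbs => ->.
have := nbwalk_uniq nb; rewrite -cat_rcons -rev_cons cat_uniq size_cat size_rev.
have le8 : size (y :: s) + size [:: x, z & t] <= 8 by move: le7 => /=; lia.
move=> /(_ le8) /and3P[_ /negP[]]; apply/hasP; exists (last z t).
  by rewrite inE mem_last orbT.
by rewrite mem_rev -els mem_last.
Qed.

End Walks.

(** * Cycles as edge sets and as vertex sequences *)

Section CycleEdges.

Variables (T : finType) (e : rel T).

Lemma mem_cycle_edges (c : seq T) x y :
  reflect (x \in c /\ next c x = y \/ y \in c /\ next c y = x)
          ([set x; y] \in cycle_edges c).
Proof.
apply: (iffP imsetP) => [[u uc exy]|]; last first.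
  by case=> -[uc <-]; [exists x | exists y; rewrite // setUC].
have: x \in [set u; next c u] by rewrite -exy set21.
have: y \in [set u; next c u] by rewrite -exy set22.
have: u \in [set x; y] by rewrite exy set21.
have: next c u \in [set x; y] by rewrite exy set22.
rewrite !inE => /pred2P nP /pred2P uP /pred2P yP /pred2P xP.
case: xP => [xu|xn]; [left; rewrite xu; split=> // | right].
  by case: yP nP => ? [?|?]; congruence.
suff -> : y = u by [].
by case: yP uP => ? [?|?]; congruence.
Qed.

Lemma cycle_edges_rot n (c : seq T) :
  uniq c -> cycle_edges (rot n c) = cycle_edges c.
Proof.
move=> uc; apply/setP=> E; apply/imsetP/imsetP => -[u uc' ->]; exists u => //.
- by rewrite mem_rot in uc'.
- by rewrite next_rot.
- by rewrite mem_rot.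
by rewrite next_rot.
Qed.

Lemma cycle_edges_rev (c : seq T) :
  uniq c -> cycle_edges (rev c) = cycle_edges c.
Proof.
move=> uc; apply/setP=> E; apply/imsetP/imsetP => -[u uc' ->].
  exists (prev c u); first by rewrite mem_prev -mem_rev.
  by rewrite next_rev // next_prev // setUC.
exists (next c u); first by rewrite mem_rev mem_next.
by rewrite next_rev // prev_next // setUC.
Qed.

Lemma next_nthS (x0 : T) (c : seq T) i :
  uniq c -> i.+1 < size c -> next c (nth x0 c i) = nth x0 c i.+1.
Proof.
move=> uc lt_i; rewrite next_nth mem_nth 1?ltnW //.
case: c uc lt_i => // y c uc lt_i.
by rewrite index_uniq 1?ltnW //=; apply: set_nth_default.
Qed.

(** The first two vertices fix starting point and orientation. After that, the next edge of [d] is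
    an edge of [c] at the current vertex; were it the edge [c] arrived by, [d] would revisit its
    previous vertex. *)
Lemma cycle_edges_inj (x y : T) (s t : seq T) :
  uniq [:: x, y & s] -> uniq [:: x, y & t] -> size s = size t ->
  cycle_edges [:: x, y & s] = cycle_edges [:: x, y & t] -> s = t.
Proof.
set c := [:: x, y & s]; set d := [:: x, y & t] => uc ud est ecd.
have szcd : size c = size d by rewrite /= est.
suff H i : i.+1 < size d -> nth x c i = nth x d i /\ nth x c i.+1 = nth x d i.+1.
  suff: c = d by case.
  apply: (@eq_from_nth _ x) => // -[|i]; first by [].
  by rewrite szcd => /H[].
elim: i => [//|i IH] lt_i; have [|ei eiS] := IH; first exact: ltnW.
split=> //.
have : [set nth x d i.+1; nth x d i.+2] \in cycle_edges c.
  rewrite ecd; apply/mem_cycle_edges; left.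
  by rewrite mem_nth 1?ltnW // next_nthS.
rewrite -eiS => /mem_cycle_edges[[_ <-]|[mem]]; first by rewrite next_nthS ?szcd.
rewrite -(@next_nthS x c i) ?szcd 1?ltnW // => /(can_inj (prev_next uc)).
rewrite ei => /eqP; rewrite nth_uniq //; [by move/eqP; lia | by do 2?apply: ltnW].
Qed.

Hypotheses (e_sym : symmetric e).

Lemma is_cycle_rot n (c : seq T) : is_cycle e (rot n c) = is_cycle e c.
Proof. by rewrite /is_cycle /ucycleb size_rot rot_cycle rot_uniq. Qed.

Lemma is_cycle_rev (c : seq T) : is_cycle e (rev c) = is_cycle e c.
Proof.
rewrite /is_cycle /ucycleb size_rev rev_cycle rev_uniq.
by rewrite (eq_cycle (e' := e)) // => u v; rewrite e_sym.
Qed.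

(** Among the orderings of a cycle through the edge, exactly one starts with [x], [y]. *)
Lemma card_cycles_through n x y : 
  #|[set C in cycles_of_length e n | [set x; y] \in C]| =
  #|[set c : n.-tuple T | is_cycle e c & prefix [:: x; y] c]|.
Proof.
set A := [set C in _ | _]; set B := [set c : n.-tuple T | _].
have inj : {in B &, injective (fun c : n.-tuple T => cycle_edges c)}.
  move=> c d; rewrite !inE => /andP[/and3P[_ _ uc] /prefixP[s ec]].
  move=> /andP[/and3P[_ _ ud] /prefixP[t ed]] ecd; apply: val_inj => /=.
  have sz : size c = size d by rewrite !size_tuple.
  rewrite ec ed /= in uc ud ecd sz *.
  by case: sz => sz; rewrite (cycle_edges_inj uc ud sz ecd).
rewrite -(card_in_imset inj); congr #|pred_of_set _|.
apply/setP => C; rewrite !inE; apply/andP/imsetP => [[/imsetP[c]]|[c]]; last first.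
  rewrite inE => /andP[cyc /prefixP[s ec]] ->; split.
    by apply/imsetP; exists c; rewrite ?inE.
  apply/mem_cycle_edges; left; rewrite ec /= mem_head eqxx; split=> //.
rewrite inE => cyc -> xyc.
(* Reverse the cycle if it runs from [y] to [x]; a rotation then puts [x] first. *)
have [d [cycd edges_d szd xd nd]] : exists d : seq T,
    [/\ is_cycle e d, cycle_edges d = cycle_edges c, size d = n, x \in d & next d x = y].
  have /and3P[_ _ uc] := cyc.
  have /mem_cycle_edges[[xc nx]|[yc ny]] := xyc.
    by exists c; rewrite size_tuple.
  exists (rev c); rewrite is_cycle_rev cycle_edges_rev // size_rev size_tuple.
  by rewrite mem_rev -ny mem_next next_rev // prev_next.
have /and3P[sz3 _ ud] := cycd.
have [i s es] := rot_to xd.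
have szs : size (x :: s) == n by rewrite -es size_rot szd.
exists (Tuple szs); last by rewrite /= -es cycle_edges_rot.
rewrite inE /= -es is_cycle_rot cycd eqxx /=.
move: (next_rot i ud x) sz3; rewrite nd -(size_rot i) es.
by case: (s) => //= z r; rewrite eqxx => ->; rewrite eqxx prefix0s.
Qed.

End CycleEdges.

(** * Walk ends and 8-cycles in cubic graphs *)

Section Cubic.

Variables (T : finType) (e : rel T).
Hypotheses (e_sym : symmetric e) (e_irr : irreflexive e).
Hypothesis girth8 : forall c : seq T, is_cycle e c -> 8 <= size c.
Hypothesis cubic : regular e 3.

Let walk_inj := nbwalk_inj e_sym e_irr girth8.

Lemma cubic_nbrs x y : e x y ->
  exists a b, [/\ a != b, a != y & b != y] /\
    [/\ e x a, e x b & forall z, e x z -> [|| z == y, z == a | z == b]].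
Proof.
move=> exy; have /cards2P[a [b [ab eN]]] : #|[set z | e x z] :\ y| == 2.
  by apply/eqP; have := cardsD1 y [set z | e x z]; rewrite cubic inE exy; lia.
have inN z : (z != y) && e x z = (z == a) || (z == b).
  by move/setP/(_ z): eN; rewrite !inE.
have := inN a; rewrite eqxx => /andP[ay xa].
have := inN b; rewrite eqxx orbT => /andP[by' xb].
exists a, b; do 2?split=> //; move=> z xz.
by have := inN z; rewrite xz andbT => <-; case: eqVneq.
Qed.

Fixpoint walk_ends n (x y : T) : {set T} :=
  if n is m.+1 then \bigcup_(z | e y z && (z != x)) walk_ends m y z else [set y].

Lemma walk_endsP n x y r : e x y ->
  reflect (exists s, [/\ size s = n, nbwalk e [:: x, y & s] & last y s = r])
          (r \in walk_ends n x y).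
Proof.
elim: n x y => [|n IH] x y exy /=.
  rewrite inE; apply: (iffP eqP) => [->|[s [/size0nil-> _ <-]] //].
  by exists [::]; rewrite /= exy.
apply: (iffP bigcupP) => [[z /andP[yz zx] /(IH _ _ yz)[s [sz nb ls]]]|[s []]].
  by exists (z :: s); rewrite /= sz exy eq_sym zx; split.
case: s => // z s [sz] nb ls.
have /= /and3P[_ xz nb1] := nb; have /= /and3P[yz _ _] := nb1.
exists z; first by rewrite yz eq_sym.
by apply/IH => //; exists s; split.
Qed.

(** The count doubles at each step: walks from [y] through its two onward neighbours have total
    length at most 6, so by girth their ends are distinct. *)
Lemma card_walk_ends n x y : e x y -> n <= 3 -> #|walk_ends n x y| = 2 ^ n.
Proof.
elim: n x y => [|n IH] x y exy le_n; first by rewrite cards1.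
have eyx : e y x by rewrite e_sym.
have [a [b [[ab ax bx] [ya yb allN]]]] := cubic_nbrs eyx.
have -> : walk_ends n.+1 x y = walk_ends n y a :|: walk_ends n y b.
  apply/setP => r; rewrite inE; apply/bigcupP/orP => /= [[z /andP[yz zx] rz]|].
    have := allN z yz; rewrite (negPf zx) /= => /orP[] /eqP <-; by [left|right].
  by case=> ?; [exists a; rewrite ?ya | exists b; rewrite ?yb].
rewrite cardsU !IH ?(ltnW le_n) //.
rewrite (_ : _ :&: _ = set0) ?cards0 ?subn0 ?addnn -?mul2n ?expnS //.
apply/setP => r; rewrite !inE; apply/negP => /andP[].
move=> /(walk_endsP _ _ ya)[s [sz nbs ls]] /(walk_endsP _ _ yb)[t [tz nbt lt]].
have := walk_inj nbs nbt; rewrite /= ls lt sz tz => /(_ erefl).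
have -> : n.+1 + n.+1 <= 7 by lia.
by move=> /(_ erefl) [eab _]; rewrite eab eqxx in ab.
Qed.

(** For a neighbour i of [x], [far x i] is the set R_i of the header. *)
Definition far x y := walk_ends 3 x y.
Arguments far : simpl never.

Lemma card_far x y : e x y -> #|far x y| = 8.
Proof. by move=> exy; rewrite card_walk_ends. Qed.

Lemma farP x y r : e x y ->
  reflect (exists p t, nbwalk e [:: x; y; p; t; r]) (r \in far x y).
Proof.
move=> exy; apply: (iffP (walk_endsP _ _ exy)) => [[s []]|[p [t nb]]].
  by case: s => [|p [|t [|? []]]] //= _ nb <-; exists p, t.
by exists [:: p; t; r].
Qed.

Lemma walk_last_edge x y p t r : nbwalk e [:: x; y; p; t; r] -> e r t.
Proof. by move=> /= /and5P[_ _ _ _ /and4P[_ _ tr _]]; rewrite e_sym. Qed.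

(** A common predecessor would be the end of two walks of length 3 from [x], which coincide by
    girth. *)
Lemma far_pred_neq x y p t y' p' t' r :
  nbwalk e [:: x; y; p; t; r] -> nbwalk e [:: x; y'; p'; t'; r] -> y != y' -> t != t'.
Proof.
move=> nb1 nb2; apply: contra_neq => ett; rewrite -ett in nb2.
have {}nb1 : nbwalk e [:: x; y; p; t] := @nbwalk_catl _ _ [:: x; y; p; t] [:: r] nb1.
have {}nb2 : nbwalk e [:: x; y'; p'; t] := @nbwalk_catl _ _ [:: x; y'; p'; t] [:: r] nb2.
by have [] := walk_inj nb1 nb2 erefl isT.
Qed.

(** The vertex opposite to [x] cuts an 8-cycle into two walks of length 4 from [x], each determined
    by its first step and its end. *)
Lemma card_cycles8_through x y a b :
    a != b -> a != y -> b != y -> e x y -> e x a -> e x b ->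
    (forall z, e x z -> [|| z == y, z == a | z == b]) ->
  #|[set C in cycles_of_length e 8 | [set x; y] \in C]| =
  #|far x y :&: far x a| + #|far x y :&: far x b|.
Proof.
move=> ab ay by' xy xa xb allN; rewrite card_cycles_through //.
set B := [set c | _].
(* Index 7 is the other neighbour of [x] on the cycle, index 4 the vertex opposite to [x]. *)
pose f (c : 8.-tuple T) := (nth x c 7, nth x c 4).
have BP (c : 8.-tuple T) : c \in B -> exists p t r t' p' y',
    [/\ val c = [:: x; y; p; t; r; t'; p'; y'], y' != y,
        nbwalk e [:: x; y; p; t; r] & nbwalk e [:: x; y'; p'; t'; r]].
  rewrite inE /is_cycle /ucycleb.
  case: c => [[|x' [|y'' [|p [|t [|r [|t' [|p' [|y' [|? ?]]]]]]]]] // sz].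
  move=> /andP[/= cu /and3P[/eqP ex /eqP ey _]].
  rewrite -{x'}ex -{y''}ey in sz cu *; case/andP: cu => cyc uq.
  exists p, t, r, t', p', y'.
  move: cyc => /and5P[-> -> -> rt /and5P[tp py yx e1 _]].
  rewrite rt /= (e_sym x y') e1 (e_sym y' p') yx (e_sym p' t') py (e_sym t' r) tp /=.
  move: uq; rewrite !inE !negb_or -!andbA.
  move=> U; do !(case/andP: U => ? U).
  by split=> //; repeat (apply/andP; split); rewrite // eq_sym.
have injf : {in B &, injective f}.
  move=> c d /BP[p [t [r [t' [p' [y' [ec _ nb1 nb2]]]]]]].
  move=> /BP[p1 [t1 [r1 [t1' [p1' [y1' [ed _ nb3 nb4]]]]]]].
  rewrite /f ec ed /= => -[ey er]; apply: val_inj; rewrite ec ed -ey -er.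
  rewrite -er in nb3; rewrite -ey -er in nb4.
  have [-> ->] := walk_inj (nbwalk_behead nb1) (nbwalk_behead nb3) erefl isT.
  by have [-> ->] := walk_inj (nbwalk_behead nb2) (nbwalk_behead nb4) erefl isT.
rewrite -(card_in_imset injf).
(* The first component keeps the union disjoint, since one vertex may lie in both intersections. *)
have -> : f @: B = setX [set a] (far x y :&: far x a) :|:
                   setX [set b] (far x y :&: far x b).
  apply/setP => -[y' r]; rewrite !inE /=; apply/imsetP/idP => [[c cB]|].
    have [p [t [r' [t' [p' [y1 [ec y1y nb1 nb2]]]]]]] := BP c cB.
    rewrite /f ec /= => -[-> ->].
    have xy1 : e x y1 by case/and3P: nb2.
    have -> /= : r' \in far x y by apply/farP => //; exists p, t.
    have : r' \in far x y1 by apply/farP => //; exists p', t'.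
    have := allN _ xy1; rewrite (negPf y1y) /= => /orP[] /eqP -> ->.
      by rewrite eqxx.
    by rewrite eqxx orbT.
  move=> H; have {H}[xy' y'y ry ry'] : [/\ e x y', y' != y, r \in far x y & r \in far x y'].
    by case/orP: H => /and3P[/eqP-> -> ->].
  have /farP[//|p [t nb1]] := ry; have /farP[//|p' [t' nb2]] := ry'.
  exists [tuple x; y; p; t; r; t'; p'; y'] => //.
  (* The last edges differ, so the two walks glue at [r] without backtracking. *)
  have tt : t != t' by apply: far_pred_neq nb1 nb2 _; rewrite eq_sym.
  have nb : nbwalk e [:: x; y; p; t; r; t'; p'; y'].
    have : nbwalk e (rev [:: y'; p'; t'; r]) by rewrite nbwalk_rev // (nbwalk_behead nb2).
    move: nb1; rewrite /rev /= => /and5P[-> -> -> -> /and4P[-> -> -> _]].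
    by rewrite tt /= => ->.
  rewrite inE; apply/andP; split; last by rewrite /= !eqxx.
  apply/and3P; split=> //; last exact: nbwalk_uniq nb _.
  by have := nbwalk_path nb; rewrite /= (e_sym y' x) xy' !andbT.
have dis U V : setX [set a] U :&: setX [set b] V = set0 :> {set T * T}.
  apply/setP => -[y' r]; rewrite !inE /=; apply/negP => /andP[/andP[/eqP-> _]].
  by rewrite (negPf ab).
by rewrite cardsU dis cards0 subn0 !cardsX !cards1 !mul1n.
Qed.

(** * Fourteen 8-cycles on every edge *)

Hypothesis edge14 : forall x y, e x y ->
  #|[set C in cycles_of_length e 8 | [set x; y] \in C]| = 14.

Lemma cubic_third x y a : e x y -> e x a -> y != a ->
  exists b, [/\ b != y, b != a, e x b
              & forall z, e x z -> [|| z == y, z == a | z == b]].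
Proof.
move=> xy xa ya; have [b [c [[bc yb yc] [xb xc allN]]]] := cubic_nbrs xy.
have := allN a xa; rewrite eq_sym (negPf ya) /= => /orP[] /eqP ea; subst a.
  by exists c; split; rewrite // eq_sym.
exists b; split=> // z /allN; by rewrite [(z == b) || _]orbC.
Qed.

Lemma cubic_nbr_cases r a b c w : e r a -> e r b -> e r c ->
  a != b -> a != c -> b != c -> e r w -> [|| w == a, w == b | w == c].
Proof.
move=> ra rb rc ab ac bc rw; have [d [_ _ _ allN]] := cubic_third ra rb ab.
have := allN c rc; rewrite ![c == _]eq_sym (negPf ac) (negPf bc) /= eq_sym => /eqP ->.
exact: allN.
Qed.

(** The three edges at [x] say that any two of the three pairwise intersections have sizes adding up
    to 14. *)
Lemma card_farI x y a : e x y -> e x a -> y != a -> #|far x y :&: far x a| = 7.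
Proof.
move=> xy xa ya; have [b [yb ab xb allN]] := cubic_third xy xa ya.
have Ny z : e x z -> [|| z == y, z == a | z == b] by exact: allN.
have Na z : e x z -> [|| z == a, z == y | z == b].
  by move/allN; case/or3P => ->; rewrite ?orbT.
have Nb z : e x z -> [|| z == b, z == y | z == a].
  by move/allN; case/or3P => ->; rewrite ?orbT.
have ay : a != y by rewrite eq_sym.
have by' : y != b by rewrite eq_sym.
have ba : a != b by rewrite eq_sym.
have := card_cycles8_through ba ay yb xy xa xb Ny.
have := card_cycles8_through by' ya ab xa xy xb Na.
have := card_cycles8_through ya by' ba xb xy xa Nb.
rewrite !edge14 // (setIC (far x a) (far x y)).
rewrite (setIC (far x b) (far x y)) (setIC (far x b) (far x a)).
lia.
Qed.

(** Only 8 - 7 = 1 vertex of [far x y] lies outside [far x a]. *)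
Lemma far_only x y a r r' : e x y -> e x a -> y != a ->
  r \in far x y -> r \notin far x a -> r' \in far x y -> r' \notin far x a ->
  r = r'.
Proof.
move=> xy xa ya ry ra r'y r'a.
have : #|far x y :\: far x a| == 1.
  by rewrite cardsD card_far // card_farI.
case/cards1P => s es.
have := in_set1 r s; have := in_set1 r' s; rewrite -es !inE ry ra r'y r'a /=.
by move=> /esym/eqP-> /esym/eqP.
Qed.

(** Let [c], [p] lead from [y] to [u]. The two neighbours of [u] other than [p] lie in [far y c], so
    by [far_only] at [y] one of them lies in [far y x]; its walk from [y] through [x], prolonged to
    [u], leaves [x] by [a] or [b]. *)
Lemma far_cover x y a b u : e x y -> 
    (forall z, e x z -> [|| z == y, z == a | z == b]) ->
  u \in far x y -> (u \in far x a) || (u \in far x b).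
Proof.
move=> xy allN /farP[//|c [p nb]].
have key z : e u z -> z != p -> z \in far y x -> (u \in far x a) || (u \in far x b).
  move=> uz zp /farP[|q [t nbz]]; first by rewrite e_sym.
  (* Otherwise [u] is reached from [x] both in two and in four steps. *)
  have tu : t != u.
    apply/eqP => tu; rewrite tu in nbz.
    have nbq : nbwalk e [:: x; q; u] :=
      @nbwalk_catl _ _ [:: x; q; u] [:: z] (nbwalk_behead nbz).
    by have := walk_inj nb nbq erefl isT.
  have {}nbz : nbwalk e [:: x; q; t; z; u].
    apply: (@nbwalk_glue _ _ [:: x; q] t z [:: u]); first exact: nbwalk_behead nbz.
    by case/and5P: nbz => _ _ _ _ /= /and3P[_ _ /andP[-> _]]; rewrite tu e_sym uz.
  have xq : e x q by case/and3P: nbz.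
  have yq : q != y.
    apply/eqP => qy; rewrite qy in nbz.
    have := walk_inj (nbwalk_behead nbz) (nbwalk_behead nb) erefl isT.
    by case=> _ zp'; rewrite zp' eqxx in zp.
  have : u \in far x q by apply/farP => //; exists t, z.
  by have := allN q xq; rewrite (negPf yq) /= => /orP[] /eqP-> ->; rewrite ?orbT.
move: (nb) => /= /and5P[_ xc yc yp /and4P[cp cu pu _]].
have yx : e y x by rewrite e_sym.
have up : e u p by rewrite e_sym.
have [z [z' [[zz' zp z'p] [uz uz' _]]]] := cubic_nbrs up.
have far_yc v : e u v -> v != p -> v \in far y c.
  move=> uv vp; apply/farP => //; exists p, u.
  apply: (@nbwalk_glue _ _ [:: y; c] p u [:: v]).
    exact: (nbwalk_behead nb).
  by rewrite /= pu uv eq_sym vp.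
have [/key->//|z_far] := boolP (z \in far y x).
have [/key->//|z'_far] := boolP (z' \in far y x).
have cx : c != x by rewrite eq_sym.
have ezz' := far_only yc yx cx (far_yc _ uz zp) z_far (far_yc _ uz' z'p) z'_far.
by rewrite ezz' eqxx in zz'.
Qed.

(* [d] is the vertex d_ij of the header. *)
Definition double x i j d :=
  [&& d \in far x i, d \in far x j
    & [forall k, e x k && (d \in far x k) ==> (k == i) || (k == j)]].

Lemma doubleC x i j d : double x i j d = double x j i d.
Proof.
by rewrite /double andbCA; do 2!congr (_ && _); apply: eq_forallb => k; rewrite orbC.
Qed.

Lemma doubleP x i j k d : e x k -> i != k -> j != k ->
    (forall z, e x z -> [|| z == i, z == j | z == k]) ->
  reflect [/\ d \in far x i, d \in far x j & d \notin far x k] (double x i j d).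
Proof.
move=> xk ik jk allN; apply: (iffP and3P) => -[di dj dk]; split=> //.
  by apply/negP=> dk'; move/forallP/(_ k): dk;
    rewrite xk dk' ![k == _]eq_sym (negPf ik) (negPf jk).
apply/forallP => z; apply/implyP => /andP[/allN zN dz].
by case/or3P: zN => [->|->|/eqP ezk] //; rewrite ?orbT //; rewrite ezk (negPf dk) in dz.
Qed.

(** The one vertex of [far x i] outside [far x k] must lie in [far x j] by [far_cover]. *)
Lemma exists_double x i j : e x i -> e x j -> i != j -> exists d, double x i j d.
Proof.
move=> xi xj ij; have [k [ki kj xk allN]] := cubic_third xi xj ij.
have ik : i != k by rewrite eq_sym.
have jk : j != k by rewrite eq_sym.
have : #|far x i :\: far x k| == 1 by rewrite cardsD card_far // card_farI.
case/cards1P => d ed; have := set11 d; rewrite -ed inE => /andP[dk di].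
exists d; apply/(doubleP _ xk ik jk) => //; split=> //.
have allN' z : e x z -> [|| z == i, z == j | z == k] by exact: allN.
by have := far_cover xi allN' di; rewrite (negPf dk) orbF.
Qed.

(* For a [double x i j d], [w] is the neighbour of [d] lying neither on the walk
   from [x] through [i] nor on the one through [j]. *)
Definition third_nbr x d w :=
  e d w /\ forall y p t, nbwalk e [:: x; y; p; t; d] -> t != w.

(** Seen from [i], take [w] double for the two neighbours of [i] other than [x]. Its predecessors on
    the two walks from [i] are distinct, lie in [far x i] and turn out to be [dij] and [dik]. *)
Lemma common_third x i j k dij dik :
    i != j -> i != k -> j != k -> e x i -> e x j -> e x k ->
    (forall z, e x z -> [|| z == i, z == j | z == k]) ->
    double x i j dij -> double x i k dik ->
  exists w, third_nbr x dij w /\ third_nbr x dik w.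
Proof.
move=> ij ik jk xi xj xk allN.
have allN' z : e x z -> [|| z == i, z == k | z == j].
  by move/allN; case/or3P => ->; rewrite ?orbT.
have kj : k != j by rewrite eq_sym.
move=> /(doubleP _ xk ik jk allN)[dij_i dij_j dij_k].
move=> /(doubleP _ xj ij kj allN')[dik_i dik_k dik_j].
have ix : e i x by rewrite e_sym.
have [a [b [[ab ax bx] [ia ib iN]]]] := cubic_nbrs ix.
have [w] := exists_double ia ib ab.
have iN' z : e i z -> [|| z == a, z == b | z == x].
  by move/iN; case/or3P => ->; rewrite ?orbT.
move=> /(doubleP _ ix ax bx iN')[w_a w_b w_x].
have step c : e i c -> c != x -> w \in far i c ->
    exists q r, [/\ nbwalk e [:: i; c; q; r; w], r = dij \/ r = dik & third_nbr x r w].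
  move=> ic cx /farP[//|q [r nb]]; exists q, r.
  move: (nb) => /= /and5P[_ iq cq cr /and4P[qr qw rw _]].
  have nbx : nbwalk e [:: x; i; c; q; r].
    by rewrite /= xi eq_sym cx ic iq cq cr qr.
  have ri : r \in far x i by apply/farP => //; exists c, q.
  have third : third_nbr x r w.
    split=> // y p t nby; have xy : e x y by case/and3P: nby.
    have [yi|yi] := eqVneq y i.
      rewrite yi in nby.
      by have [_ ->] := walk_inj (nbwalk_behead nby) (nbwalk_behead nbx) erefl isT.
    (* Otherwise [i], [x], [y], [p], [w] is a walk that puts [w] in [far i x]. *)
    apply/eqP => tw; rewrite tw in nby; case/negP: w_x; apply/farP => //; exists y, p.
    apply: (@nbwalk_glue _ _ [:: i] x y [:: p; w]); first by rewrite /= ix xy eq_sym yi.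
    exact: (@nbwalk_catl _ _ [:: x; y; p; w] [:: r]).
  split=> //; have [rk|rk] := boolP (r \in far x k); last first.
    by left; exact: (far_only xi xk ik ri rk dij_i dij_k).
  have [rj|rj] := boolP (r \in far x j); last first.
    by right; exact: (far_only xi xj ij ri rj dik_i dik_j).
  have /farP[//|pj [tj nbj]] := rj; have /farP[//|pk [tk nbk]] := rk.
  (* If [r] lay in all three far sets, its predecessors on the three walks would be all its
     neighbours, leaving no room for [w]. *)
  have := cubic_nbr_cases (walk_last_edge nbx) (walk_last_edge nbj)
    (walk_last_edge nbk) (far_pred_neq nbx nbj ij) (far_pred_neq nbx nbk ik)
    (far_pred_neq nbj nbk jk) rw.
  case: third => _ third.
  rewrite ![w == _]eq_sym (negPf (third _ _ _ nbx)).
  by rewrite (negPf (third _ _ _ nbj)) (negPf (third _ _ _ nbk)).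
have [q [r [nb1 r1 th1]]] := step a ia ax w_a.
have [q' [r' [nb2 r2 th2]]] := step b ib bx w_b.
have rr' : r != r' by apply: far_pred_neq nb1 nb2 ab.
exists w; case: r1 r2 th1 th2 rr' => [->|->] [->|->] //; by rewrite eqxx.
Qed.

(** The predecessors of [d] through [i] and through [j] are distinct and use up two of its three
    neighbours. *)
Lemma third_nbr_inj x i j d w w' : i != j -> d \in far x i -> d \in far x j ->
  e x i -> e x j -> third_nbr x d w -> third_nbr x d w' -> w = w'.
Proof.
move=> ij di dj xi xj [dw wN] [dw' w'N].
have /farP[//|p [t nb]] := di; have /farP[//|p' [t' nb']] := dj.
have := cubic_nbr_cases (walk_last_edge nb) (walk_last_edge nb') dw
  (far_pred_neq nb nb' ij) (wN _ _ _ nb) (wN _ _ _ nb') dw'.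
by rewrite ![w' == _]eq_sym (negPf (w'N _ _ _ nb)) (negPf (w'N _ _ _ nb')) => /eqP.
Qed.

(** With [y] = i and [d] = d_ij, these are p_ij, q_ij, a_ij and b_ij of the header. *)
Definition arm x y d p q a b :=
  [/\ nbwalk e [:: x; y; p; q; d], nbwalk e [:: x; y; p; q; b],
      nbwalk e [:: x; y; p; a], a != q & b != d] /\
  forall z, e p z -> [|| z == y, z == q | z == a].

Lemma exists_arm x y d : e x y -> d \in far x y ->
  exists p q a b, arm x y d p q a b.
Proof.
move=> xy /farP[//|p [q nb]]; exists p, q.
move: (nb) => /= /and5P[_ xp yp yq /and4P[pq pd qd _]].
have py : e p y by rewrite e_sym.
have [a [ay aq pa pN]] := cubic_third py pq yq.
have qp : e q p by rewrite e_sym.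
have [b [bp bd qb _]] := cubic_third qp qd pd.
exists a, b; split=> //; split=> //=.
  by rewrite xy xp yp yq pq eq_sym bp qb.
by rewrite xy xp yp eq_sym ay pa.
Qed.

Lemma branch_neq x i j s t : nbwalk e [:: x, i & s] -> nbwalk e [:: x, j & t] ->
  i != j -> size s + size t <= 5 -> last i s != last j t.
Proof.
move=> nbs nbt ij le5; apply/eqP => eij.
have le7 : size (i :: s) + size (j :: t) <= 7 by move: le5 => /=; lia.
have [ij' _] := walk_inj nbs nbt eij le7.
by rewrite ij' eqxx in ij.
Qed.

(** * The contradiction around the common neighbour [w] *)

Section Hub.

Variables (x w : T) (d p q a b : T -> T -> T).

Let N2 i j := [&& e x i, e x j & i != j].
Let N3 i j k := [/\ N2 i j, N2 i k & N2 j k].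

Hypothesis dC : forall i j, d i j = d j i.
Hypothesis d_double : forall i j, N2 i j -> double x i j (d i j).
Hypothesis d_w : forall i j, N2 i j -> third_nbr x (d i j) w.
(** Unlike [d i j], these vertices depend on the order of the indices: they belong to the branch
    through [i]. *)
Hypothesis arms : forall i j, N2 i j -> arm x i (d i j) (p i j) (q i j) (a i j) (b i j).

Lemma N2C i j : N2 i j = N2 j i.
Proof. by rewrite /N2 andbCA eq_sym. Qed.

Lemma N3_rot i j k : N3 i j k -> N3 j k i.
Proof. by case=> ij ik jk; split; rewrite // N2C. Qed.

Lemma N3_swap i j k : N3 i j k -> N3 i k j.
Proof. by case=> ij ik jk; split; rewrite // N2C. Qed.

Lemma edge_qd i j : N2 i j -> e (q i j) (d i j).
Proof. by case/arms=> -[/= /and5P[_ _ _ _ /and4P[]]]. Qed.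

Lemma edge_pq i j : N2 i j -> e (p i j) (q i j).
Proof. by case/arms=> -[/= /and5P[_ _ _ _ /and4P[]]]. Qed.

Lemma edge_pa i j : N2 i j -> e (p i j) (a i j).
Proof. by case/arms=> -[_ _ /= /and5P[_ _ _ _ /andP[]]]. Qed.

Lemma edge_qb i j : N2 i j -> e (q i j) (b i j).
Proof. by case/arms=> -[_ /= /and5P[_ _ _ _ /and4P[]]]. Qed.

Lemma edge_dw i j : N2 i j -> e (d i j) w.
Proof. by case/d_w. Qed.

Lemma neq_qw i j : N2 i j -> q i j != w.
Proof.
by move=> ij; case: (arms ij) => -[nb _ _ _ _] _; case: (d_w ij) => _ /(_ _ _ _ nb).
Qed.

Lemma branch_qq i j k l : N2 i k -> N2 j l -> i != j -> q i k != q j l.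
Proof.
move=> /arms[[nb _ _ _ _] _] /arms[[nb' _ _ _ _] _] ij.
exact: (branch_neq (@nbwalk_catl _ _ [:: x; i; p i k; q i k] [:: d i k] nb)
                   (@nbwalk_catl _ _ [:: x; j; p j l; q j l] [:: d j l] nb') ij isT).
Qed.

Lemma branch_aq i j k l : N2 i k -> N2 j l -> i != j -> a i k != q j l.
Proof.
move=> /arms[[_ _ nb _ _] _] /arms[[nb' _ _ _ _] _] ij.
exact: (branch_neq nb (@nbwalk_catl _ _ [:: x; j; p j l; q j l] [:: d j l] nb') ij isT).
Qed.

Lemma branch_aa i j k l : N2 i k -> N2 j l -> i != j -> a i k != a j l.
Proof.
move=> /arms[[_ _ nb _ _] _] /arms[[_ _ nb' _ _] _] ij.
exact: (branch_neq nb nb' ij isT).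
Qed.

Lemma branch_bp i j k l : N2 i k -> N2 j l -> i != j -> b i k != p j l.
Proof.
move=> /arms[[_ nb _ _ _] _] /arms[[_ _ nb' _ _] _] ij.
exact: (branch_neq nb (@nbwalk_catl _ _ [:: x; j; p j l] [:: a j l] nb') ij isT).
Qed.

Lemma d_far i j : N2 i j -> d i j \in far x i.
Proof. by case/d_double/and3P. Qed.

Lemma d_nfar i j k : N3 i j k -> d i j \notin far x k.
Proof.
case=> ij /and3P[_ xk ik] /and3P[_ _ jk].
have /and3P[_ _ /forallP/(_ k)] := d_double ij.
by rewrite xk ![k == _]eq_sym (negPf ik) (negPf jk) implybF.
Qed.

Lemma neq_dd i j k : N3 i j k -> d i j != d i k.
Proof.
move=> ijk; apply: contraNneq (d_nfar ijk) => ->; rewrite dC; apply: d_far.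
by case: ijk => _ ik _; rewrite N2C.
Qed.

(** Otherwise [q i j] and [w] have the two common neighbours [d u v] and [d i j], a 4-cycle. *)
Lemma neq_bd i j u v : N2 i j -> N2 u v -> b i j != d u v.
Proof.
move=> ij uv; apply/eqP => ebd; have := edge_qb ij; rewrite ebd => qduv.
have nb1 : nbwalk e [:: q i j; d u v; w] by rewrite /= qduv neq_qw ?edge_dw.
have nb2 : nbwalk e [:: q i j; d i j; w] by rewrite /= edge_qd ?neq_qw ?edge_dw.
have [edd] := walk_inj nb1 nb2 erefl isT.
by case: (arms ij) => -[_ _ _ _ /eqP[]]; rewrite ebd.
Qed.

(** A common [p] would have two walks of length 3 to [w], through the distinct vertices [d i j] and
    [d i k]. *)
Lemma neq_pp i j k : N3 i j k -> p i j != p i k.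
Proof.
move=> ijk; have [ij ik _] := ijk; apply/eqP => epp.
have nb u : N2 i u -> nbwalk e [:: p i u; q i u; d i u; w].
  move=> iu; rewrite /= edge_pq ?edge_qd ?edge_dw ?neq_qw //.
  by case: (arms iu) => -[/= /and5P[_ _ _ _ /and4P[_ -> _ _]]].
have nbj := nb _ ij; rewrite epp in nbj.
have [_ edd] := walk_inj nbj (nb _ ik) erefl isT.
by have := neq_dd ijk; rewrite edd eqxx.
Qed.

Lemma far_b i j : N2 i j -> b i j \in far x i.
Proof.
move=> ij; have [[_ nb _ _ _] _] := arms ij; apply/farP; first by case/and3P: ij.
by exists (p i j), (q i j).
Qed.

(** The only vertex of [far x i] outside [far x m] is [d i n], so [b i j] is in [far x m]. Its
    predecessor [t] there follows [p m i] or [p m n], and is the [a] rather than the [q] of that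
    arm. *)
Lemma edge_ba_cases i m n j : N3 i m n -> (j == m) || (j == n) ->
  e (b i j) (a m i) || e (b i j) (a m n).
Proof.
move=> imn jmn; have [im in_ mn] := imn.
have ij : N2 i j by case/orP: jmn => /eqP->.
have xm : e x m by case/and3P: im.
have i_neq_m : i != m by case/and3P: im.
have m_neq_i : m != i by rewrite eq_sym.
have mi : N2 m i by rewrite N2C.
have b_m : b i j \in far x m.
  have [//|b_m] := boolP (b i j \in far x m); have xi : e x i by case/and3P: im.
  have := neq_bd ij in_.
  by rewrite (far_only xi xm i_neq_m (far_b ij) b_m (d_far in_) (d_nfar (N3_swap imn))) eqxx.
have /farP[//|p' [t nb]] := b_m.
have tb : e (b i j) t by rewrite e_sym; case/and5P: nb => _ _ _ _ /= /and4P[].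
(* Otherwise [b i j], [q m u], [d m u], [w], [d i j], [q i j] close up too early. *)
have q_excl u : N2 m u -> t != q m u.
  move=> mu; apply/eqP => etq; have := branch_qq ij mu i_neq_m.
  have nb1 : nbwalk e [:: b i j; q m u; d m u; w].
    by rewrite /= -{1}etq tb neq_bd ?edge_qd ?neq_qw ?edge_dw.
  have nb2 : nbwalk e [:: b i j; q i j; d i j; w].
    by rewrite /= e_sym edge_qb ?neq_bd ?edge_qd ?neq_qw ?edge_dw.
  by have [-> _] := walk_inj nb1 nb2 erefl isT; rewrite eqxx.
have step u : N2 m u -> p' = p m u -> e (b i j) (a m u).
  move=> mu ep; have [_ pN] := arms mu.
  have /= /and5P[_ _ mp' mt /and4P[pt _ _ _]] := nb.
  rewrite ep in pt; have := pN t pt; rewrite eq_sym (negPf mt) (negPf (q_excl _ mu)) /=.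
  by move/eqP <-.
have mx : e m x by rewrite e_sym.
have mp u : N2 m u -> e m (p m u) && (p m u != x).
  by case/arms=> -[/= /and5P[_ xp -> _ _] _ _ _ _] _; rewrite eq_sym.
have /andP[mpi pix] := mp _ mi; have /andP[mpn pnx] := mp _ mn.
have /= /and5P[_ xp' mp' _ _] := nb.
have pin : p m i != p m n by apply: neq_pp; apply: N3_swap; apply: N3_rot.
have := cubic_nbr_cases mpi mpn mx pin pix pnx mp'.
by rewrite [p' == x]eq_sym (negPf xp') orbF => /orP[] /eqP /step-> //; rewrite orbT.
Qed.

(** The alternative [a j i] gives two walks from [b i j] to [q j i]: through [a j i], [p j i] and
    through [q i j], [d i j]. *)
Lemma edge_b_a i j k : N3 i j k -> e (b i j) (a j k).
Proof.
move=> ijk; have [ij _ _] := ijk; have ji : N2 j i by rewrite N2C.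
have := edge_ba_cases ijk; move=> /(_ j); rewrite eqxx => /(_ isT) /orP[] // ba.
have /and3P[_ _ i_neq_j] := ij; have j_neq_i : j != i by rewrite eq_sym.
have nb1 : nbwalk e [:: b i j; a j i; p j i; q j i].
  rewrite /= ba branch_bp // e_sym edge_pa // edge_pq // andbT.
  by case: (arms ji) => -[_ _ _ -> _].
have nb2 : nbwalk e [:: b i j; q i j; d i j; q j i].
  by rewrite /= e_sym edge_qb // neq_bd // edge_qd // branch_qq // e_sym dC edge_qd.
have [eaq _] := walk_inj nb1 nb2 erefl isT.
by have := branch_aq ji ij j_neq_i; rewrite eaq eqxx.
Qed.

(** The alternative [a k i] gives two walks from [a k i] to [p j k]: through [b i j], [a j k] and
    through [b j k], [q j k]. *)
Lemma edge_b_a' i j k : N3 i j k -> e (b i j) (a k j).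
Proof.
move=> ijk; have [ij ik jk] := ijk; have ki : N2 k i by rewrite N2C.
have := edge_ba_cases (N3_swap ijk); move=> /(_ j); rewrite eqxx orbT => /(_ isT) /orP[] // ba.
have /and3P[_ _ i_neq_j] := ij; have /and3P[_ _ j_neq_k] := jk.
have k_neq_j : k != j by rewrite eq_sym.
have nb1 : nbwalk e [:: a k i; b i j; a j k; p j k].
  rewrite /= e_sym ba branch_aa // edge_b_a // branch_bp // andbT.
  by rewrite e_sym edge_pa.
have nb2 : nbwalk e [:: a k i; b j k; q j k; p j k].
  rewrite /= e_sym edge_b_a; last exact: N3_rot.
  rewrite branch_aq // e_sym edge_qb // eq_sym andbT /=.
  rewrite [e (q j k) _]e_sym edge_pq // andbT.
  by case: (arms jk) => -[_ /= /and5P[_ _ _ _ /and4P[_ ->]]].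
have [_ eaq] := walk_inj nb1 nb2 erefl isT.
by case: (arms jk) => -[_ _ _ /eqP[]].
Qed.

Lemma hub_false i j k : N3 i j k -> False.
Proof.
move=> ijk; have [ij ik jk] := ijk; have kj : N2 k j by rewrite N2C.
have /and3P[_ _ j_neq_k] := jk.
have ikj := N3_swap ijk.
have nb1 : nbwalk e [:: a j k; b i j; a k j].
  by rewrite /= e_sym edge_b_a // branch_aa // edge_b_a'.
have nb2 : nbwalk e [:: a j k; b i k; a k j].
  by rewrite /= e_sym edge_b_a' // branch_aa // edge_b_a.
(* The 4-cycle must degenerate to [b i j = b i k]; the walks from [i] to this vertex then coincide,
   against [neq_pp]. *)
have [ebb] := walk_inj nb1 nb2 erefl isT.
have [[_ nbj _ _ _] _] := arms ij; have [[_ nbk _ _ _] _] := arms ik.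
rewrite -ebb in nbk.
have [epp _] := walk_inj (nbwalk_behead nbj) (nbwalk_behead nbk) erefl isT.
by have := neq_pp ijk; rewrite epp eqxx.
Qed.

End Hub.

(** * Choice of the configuration around a vertex *)

Lemma no_vertex_with_14_cycles_per_edge (x : T) : False.
Proof.
have /card_gt0P[i] : 0 < #|[set y | e x y]| by rewrite cubic.
rewrite inE => xi; have [j [k [[jk ji ki] [xj xk allN]]]] := cubic_nbrs xi.
have ij : i != j by rewrite eq_sym.
have ik : i != k by rewrite eq_sym.
(* The default [x] is never reached for distinct neighbours [u], [v]. Picking by a predicate
   symmetric in [u], [v] makes [d] symmetric. *)
pose d u v := odflt x [pick r | double x u v r].
have dC u v : d u v = d v u.
  by rewrite /d; congr odflt; apply: eq_pick => r; rewrite doubleC.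
have dP u v : [&& e x u, e x v & u != v] -> double x u v (d u v).
  case/and3P=> xu xv uv; rewrite /d; case: pickP => [//|no].
  by have [r] := exists_double xu xv uv; rewrite no.
have dij : double x i j (d i j) by apply: dP; rewrite xi xj ij.
have dik : double x i k (d i k) by apply: dP; rewrite xi xk ik.
have dji : double x j i (d i j) by rewrite doubleC.
have djk : double x j k (d j k) by apply: dP; rewrite xj xk jk.
have [w [wij wik]] := common_third ij ik jk xi xj xk allN dij dik.
have allN' z : e x z -> [|| z == j, z == i | z == k].
  by move/allN; rewrite orbCA.
have [w' [w'ij w'jk]] := common_third ji jk ik xj xi xk allN' dji djk.
(* The vertices found from [i] and from [j] are both the third neighbour of [d i j], hence equal. *)
have ww : w = w'.
  by case/and3P: dij => di dj _; apply: third_nbr_inj ij di dj xi xj wij w'ij.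
rewrite -{}ww {w'} in w'ij w'jk.
have dw u v : [&& e x u, e x v & u != v] -> third_nbr x (d u v) w.
  case/and3P=> /allN + /allN.
  by case/or3P=> /eqP-> /or3P[] /eqP->; rewrite ?eqxx // 1?[d j i]dC 1?[d k i]dC 1?[d k j]dC.
have armP (uv : T * T) : exists f : T * T * T * T,
    [&& e x uv.1, e x uv.2 & uv.1 != uv.2] ->
    arm x uv.1 (d uv.1 uv.2) f.1.1.1 f.1.1.2 f.1.2 f.2.
  have [N|_] := boolP [&& e x uv.1, e x uv.2 & uv.1 != uv.2]; last by exists (x, x, x, x).
  have /and3P[du _ _] := dP _ _ N; have /and3P[xu _ _] := N.
  by have [p [q [a [b A]]]] := exists_arm xu du; exists (p, q, a, b).
have [f fP] := fin_all_exists armP.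
apply: (@hub_false x w d (fun u v => (f (u, v)).1.1.1) (fun u v => (f (u, v)).1.1.2)
  (fun u v => (f (u, v)).1.2) (fun u v => (f (u, v)).2) dC dP dw (fun u v => fP (u, v)) i j k).
by rewrite xi xj xk ij ik jk.
Qed.

End Cubic.

Theorem theorem2 (v : nat) (hv : 0 < v) :
  ~ (exists (T : finType) (e : rel T), egr e v 3 8 14).
Proof.
case=> T [e [[e_sym e_irr] cardT cubic [_ girth8] edge14]].
have /card_gt0P[x _] : 0 < #|T| by rewrite cardT.
exact: (no_vertex_with_14_cycles_per_edge e_sym e_irr girth8 cubic edge14 x).
Qed.
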